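(* The following assertions hold. (1) Let $g_1,\ldots,g_l,f_1,\ldots,f_r\in\mathbb C[x_1,\ldots,x_n]$ be homogeneous polynomials of the same degree $d$ such that each $g_a$ belongs to the $\mathbb C$-linear span of $f_1,\ldots,f_r$. If $g_1,\ldots,g_l$ satisfy (P), then $f_1,\ldots,f_r$ also satisfy (P). (2) Let $f_1,\ldots,f_r\in\mathbb C[x_1,\ldots,x_n]$ and $g_1,\ldots,g_l\in\mathbb C[y_1,\ldots,y_m]$ be homogeneous polynomials of degree $d$. If $f_1,\ldots,f_r$ and $g_1,\ldots,g_l$ both satisfy (P), then, regarded as polynomials in $\mathbb C[x_1,\ldots,x_n,y_1,\ldots,y_m]$, the polynomials $f_1,\ldots,f_r,g_1,\ldots,g_l$ also satisfy (P). (3) Let $f\in\mathbb C[x_1,\ldots,x_n]$ and $g\in\mathbb C[y_1,\ldots,y_m]$ be homogeneous polynomials of degrees $d$ and $e$, respectively, with $n/d=m/e$. If each of $f$ and $g$ satisfies (P) as a single polynomial, then $fg$ satisfies (P) as a single polynomial in $\mathbb C[x_1,\ldots,x_n,y_1,\ldots,y_m]$. (4) Let $f\in\mathbb C[x_1,\ldots,x_n]$ and $g\in\mathbb C[y_1,\ldots,y_m]$ be homogeneous polynomials of degree $d$, with $d\ge2$. If $f$ and $g$ each satisfy (P) as a single polynomial, then $f+g$ satisfies (P) as a single polynomial in $\mathbb C[x_1,\ldots,x_n,y_1,\ldots,y_m]$.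
   Context: Property (P): homogeneous polynomials $f_1,\ldots,f_r\in\mathbb C[x_1,\ldots,x_N]$ of a common degree $d$ satisfy (P) if there exist polynomials $P_\alpha\in\mathbb C[x_1,\ldots,x_N]$, indexed by $\alpha\in\mathbb Z_{\ge0}^r$, such that (i) $P_\alpha$ is homogeneous of degree $d(\alpha_1+\cdots+\alpha_r)$; (ii) $P_0\ne0$; (iii) $x_iP_\alpha=\sum_{k=1}^r(\partial_if_k)(\partial)P_{\alpha+e_k}$ for all $1\le i\le N$ and all $\alpha\in\mathbb Z_{\ge0}^r$. Here $e_k$ is the $k$-th standard basis vector of $\mathbb Z^r$, $\partial_i=\partial/\partial x_i$, and $h(\partial)$ denotes the differential operator obtained from a polynomial $h$ by replacing each variable by the corresponding partial derivative; so $(\partial_if_k)(\partial)$ is obtained from $\partial f_k/\partial x_i$. ''As a single polynomial'' means the case $r=1$. The zero polynomial counts as homogeneous of every degree. *)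

(* Defs.v *)
From mathcomp Require Import all_boot all_algebra.
From mathcomp Require Import reals complex mpoly.

Set Implicit Arguments.
Unset Strict Implicit.
Unset Printing Implicit Defensive.

Import GRing.Theory.
Local Open Scope ring_scope.

(* h(∂) q; here q^`M[m] is the plain iterated partial derivative, with no
   division by factorials. *)
Definition diffop (A : comNzRingType) (N : nat) (h q : {mpoly A[N]}) :
    {mpoly A[N]} :=
  \sum_(m <- msupp h) h@_m *: q^`M[m].

(* The common degree d is a parameter because it is not determined by the f k
   when they all vanish. *)
Definition propertyP (A : comNzRingType) (N r d : nat)
    (f : 'I_r -> {mpoly A[N]}) : Prop :=
  (forall k, f k \is d.-homog) /\
  exists P : 'X_{1..r} -> {mpoly A[N]},
    [/\ forall alpha, P alpha \is (d * mdeg alpha).-homog,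
        P 0%MM != 0
      & forall (i : 'I_N) (alpha : 'X_{1..r}),
          'X_i * P alpha =
            \sum_(k < r) diffop (f k)^`M(i) (P (alpha + U_(k))%MM)].

Definition single (A : comNzRingType) (N : nat) (f : {mpoly A[N]}) :
    'I_1 -> {mpoly A[N]} :=
  fun=> f.

Definition concat_family (T : Type) (r l : nat) (f : 'I_r -> T)
    (g : 'I_l -> T) : 'I_(r + l) -> T :=
  fun k => match split k with inl i => f i | inr j => g j end.

(* In A[x_1, ..., x_n, y_1, ..., y_m], x_i is the variable of index
   lshift m i and y_j the variable of index rshift n j. *)
Definition in_x (A : comNzRingType) (n m : nat) (f : {mpoly A[n]}) :
    {mpoly A[n + m]} :=
  f \mPo [tuple 'X_(lshift m i) | i < n].

Definition in_y (A : comNzRingType) (n m : nat) (g : {mpoly A[m]}) :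
    {mpoly A[n + m]} :=
  g \mPo [tuple 'X_(rshift n j) | j < m].

(* Main.v *)
Require Import Defs.
From HB Require Import structures.
From mathcomp Require Import all_boot all_algebra.
From mathcomp Require Import reals complex ssrcomplements mpoly.

(** Each part is an explicit formula for the new family in terms of the given
    ones.
    (1) If g_a = \sum_k c_{ak} f_k, extend P linearly to polynomials in
    t_1, ..., t_l by t^beta |-> P_beta; the image of
    \prod_k (\sum_a c_{ak} t_a)^{alpha_k} works for f.
    (2) Take P_alpha(x) Q_beta(y).
    (3) Euler's identity turns (iii) into f(\partial) P_{j+1} = (n/d + j) P_j, and
    likewise for g; as n/d = m/e the same factor appears on both sides, and
    c_j P_j(x) Q_j(y) works once c_{j+1} (n/d + j) = c_j.
    (4) Take \sum_{j <= k} P_j(x) Q_{k-j}(y); the extra boundary terms of (iii)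
    vanish because the derivatives of f and g have positive degree while P_0
    and Q_0 are constant. *)

Import GRing.Theory Num.Theory.
Local Open Scope ring_scope.

Set Implicit Arguments.
Unset Strict Implicit.
Unset Printing Implicit Defensive.

(** * Linear maps determined by their values on monomials *)

Section MonomialExtension.
Variables (A : comNzRingType) (n : nat) (V : lmodType A).
Implicit Types (phi : 'X_{1..n} -> V) (p : {mpoly A[n]}).

(** Serves twice: as [diffop] in its symbol, and as the extension t^beta |-> P_beta. *)
Definition mlin phi p : V := \sum_(m <- msupp p) p@_m *: phi m.

(** A common index set for polynomials with different supports, so that linearity can be read off
    termwise. *)
Lemma mlinwE phi p k : (msize p <= k)%N ->
  mlin phi p = \sum_(m : 'X_{1..n < k}) p@_m *: phi m.
Proof.
move=> le_pk; rewrite /mlin (big_mksub 'X_{1..n < k}) /=; first last.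
- by move=> m /msize_mdeg_lt/leq_trans/(_ le_pk).
- exact: msupp_uniq.
rewrite big_rmcond //= => m /memN_msupp_eq0 ->.
by rewrite scale0r.
Qed.

Lemma mlin_is_linear phi : linear (mlin phi).
Proof.
move=> c p q; pose k := maxn (msize (c *: p + q)) (maxn (msize p) (msize q)).
rewrite !(@mlinwE phi _ k) ?leq_max ?leqnn ?orbT //.
rewrite scaler_sumr -big_split /=; apply: eq_bigr => m _.
by rewrite mcoeffD mcoeffZ scalerDl scalerA.
Qed.

HB.instance Definition _ phi :=
  GRing.isLinear.Build A {mpoly A[n]} V _ (mlin phi) (mlin_is_linear phi).

Lemma mlinX phi m : mlin phi 'X_[m] = phi m.
Proof. by rewrite /mlin msuppX big_seq1 mcoeffX eqxx scale1r. Qed.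

End MonomialExtension.

(** Constants and variables generate the ring. This induction suits statements compatible with
    products. *)
Lemma mpoly_ring_ind (A : comNzRingType) n (K : {mpoly A[n]} -> Prop) :
    (forall c, K c%:MP) -> (forall i, K 'X_i) ->
    (forall p q, K p -> K q -> K (p + q)) ->
    (forall p q, K p -> K q -> K (p * q)) ->
  forall p, K p.
Proof.
move=> KC KX KD KM; elim/mpolyind => [|c m p _ _ Kp]; first exact: (KC 0).
apply: KD => //; rewrite -mul_mpolyC; apply: (KM _ _ (KC c)).
rewrite mpolyXE_id; elim/big_ind: _ => [|//|i _]; first exact: (KC 1).
elim: (m i) => [|k IHk]; first by rewrite expr0; exact: (KC 1).
by rewrite exprS; exact: KM.
Qed.

(** * Differential operators with constant coefficients *)

Section DiffOp.
Variables (A : comNzRingType) (N : nat).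
Implicit Types (h p q : {mpoly A[N]}).

Lemma diffopE h q : diffop h q = mlin (fun m => q^`M[m]) h.
Proof. by []. Qed.

Lemma diffop_is_linear h : linear (diffop h).
Proof.
move=> c p q; rewrite /diffop scaler_sumr -big_split /=.
by apply: eq_bigr => m _; rewrite linearP scalerDr !scalerA mulrC.
Qed.

HB.instance Definition _ h :=
  GRing.isLinear.Build A {mpoly A[N]} {mpoly A[N]} _ (diffop h)
    (diffop_is_linear h).

Lemma diffop0l q : diffop 0 q = 0.
Proof. by rewrite diffopE linear0. Qed.

Lemma diffopDl h1 h2 q : diffop (h1 + h2) q = diffop h1 q + diffop h2 q.
Proof. by rewrite !diffopE linearD. Qed.

Lemma diffopZl c h q : diffop (c *: h) q = c *: diffop h q.
Proof. by rewrite !diffopE linearZ. Qed.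

Lemma diffop_suml (I : Type) (s : seq I) (F : I -> {mpoly A[N]}) q :
  diffop (\sum_(i <- s) F i) q = \sum_(i <- s) diffop (F i) q.
Proof. by rewrite diffopE linear_sum. Qed.

Lemma diffopX m q : diffop 'X_[m] q = q^`M[m].
Proof. by rewrite diffopE mlinX. Qed.

Lemma diffopXU i q : diffop 'X_i q = q^`M(i).
Proof. by rewrite diffopX mderivmU1m. Qed.

Lemma diffopC c q : diffop c%:MP q = c *: q.
Proof.
by rewrite -[c%:MP]mulr1 mul_mpolyC diffopZl -mpolyX0 diffopX mderivm0m.
Qed.

(** Both sides are linear in [h1] and in [h2]; on monomials, iterated derivatives compose by adding
    exponents. *)
Lemma diffopM h1 h2 q : diffop (h1 * h2) q = diffop h1 (diffop h2 q).
Proof.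
elim/mpolyind: h1 => [|c m p _ _ IH].
  by rewrite mul0r !diffop0l.
rewrite mulrDl !diffopDl IH -scalerAl !diffopZl; congr (_ *: _ + _).
elim/mpolyind: h2 {IH} => [|c' m' p' _ _ IH'].
  by rewrite mulr0 !diffop0l linear0.
rewrite mulrDr !diffopDl linearD /= IH' -scalerAr !diffopZl linearZ /=.
by rewrite -mpolyXD addmC !diffopX mderivmDm.
Qed.

Lemma diffop_dhomog0 h d q : q \is 0.-homog -> h \is d.-homog -> (0 < d)%N ->
  diffop h q = 0.
Proof.
move=> q0 hd d_gt0; rewrite /diffop big_seq big1 // => m.
move=> /(dhomogP _ _ _ hd) /= dm.
(* Coefficients of this derivative are multiples of coefficients of [q] in degree at least
   [d > 0]. *)
suff -> : q^`M[m] = 0 by rewrite scaler0.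
apply/mpolyP => m'; rewrite mcoeff_mderivm mcoeff0.
rewrite (dhomog_nemf_coeff q0) ?mul0rn //=.
by rewrite mdegD dm -lt0n addn_gt0 d_gt0.
Qed.

End DiffOp.

(** * Homogeneity and Euler's identity *)

Lemma dhomog_deriv (A : comNzRingType) N d (p : {mpoly A[N]}) i :
  p \is d.-homog -> p^`M(i) \is d.-1.-homog.
Proof.
move=> pd; rewrite [p]mpolyE linear_sum /= big_seq; apply: rpred_sum => m mp.
rewrite linearZ /= mderivX; apply/dhomogZ.
(* This case also absorbs [d = 0], where [d.-1] is truncated. *)
have [-> | mi] := eqVneq (m i) 0%N; first by rewrite scale0r dhomog0.
apply: dhomogZ; rewrite dhomogX /=.
have /submK/(congr1 mdeg) : (U_(i) <= m)%MM by rewrite lep1mP.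
by rewrite (dhomogP _ _ _ pd _ mp) mdegD mdeg1 addn1 => <-.
Qed.

(** On x^m, the operator x_i \partial_i is multiplication by m_i, and the m_i add up to [d]. *)
Lemma euler (A : comNzRingType) N d (p : {mpoly A[N]}) : p \is d.-homog ->
  \sum_(i < N) 'X_i * p^`M(i) = d%:R *: p.
Proof.
move=> pd; rewrite {2}[p]mpolyE scaler_sumr.
under eq_bigr => i _ do rewrite {1}[p]mpolyE linear_sum mulr_sumr /=.
rewrite exchange_big /= [LHS]big_seq [RHS]big_seq; apply: eq_bigr => m mp.
rewrite -(dhomogP _ _ _ pd _ mp) /= mdegE natr_sum scaler_suml.
apply: eq_bigr => i _; rewrite linearZ /= mderivX.
have [-> | mi] := eqVneq (m i) 0%N; first by rewrite !scale0r scaler0 mulr0.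
rewrite -!scalerAr scalerA mulrC scalerA -mpolyXD addmC submK //.
by rewrite lep1mP.
Qed.

(** By the product rule each of the [N] variables contributes one copy of [p]; Euler's identity
    gives the remaining [d]. *)
Lemma sum_deriv_mulX (A : comNzRingType) N d (p : {mpoly A[N]}) :
  p \is d.-homog -> \sum_(i < N) ('X_i * p)^`M(i) = (N + d)%:R *: p.
Proof.
move=> pd; under eq_bigr => i _ do rewrite mderivM mderivX mnm1E eqxx scale1r.
rewrite big_split /= (euler pd) natrD scalerDl; congr (_ + _).
rewrite (eq_bigr (fun=> p)) => [|i _].
  by rewrite sumr_const card_ord scaler_nat.
by rewrite -{1}[U_(i)%MM]add0m addmK mpolyX0 mul1r.
Qed.

Lemma dhomog_comp (A : comNzRingType) n k d (lq : n.-tuple {mpoly A[k]})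
    (p : {mpoly A[n]}) :
  (forall i, tnth lq i \is 1.-homog) -> p \is d.-homog ->
  p \mPo lq \is d.-homog.
Proof.
move=> lq1 pd; rewrite comp_mpolyE big_seq; apply: rpred_sum => m mp.
apply: dhomogZ; rewrite -(dhomogP _ _ _ pd _ mp) /= mdegE.
elim/big_ind2: _ => [|? ? ? ? h1 h2|i _]; [exact: dhomog1|exact: dhomogM|].
by have := dhomogMn (m i) (lq1 i); rewrite mul1n.
Qed.

Lemma dhomog0_const (A : comNzRingType) n (p : {mpoly A[n]}) :
  p \is 0.-homog -> p = (p@_0)%:MP.
Proof.
move=> p0; apply/mpolyP => m; rewrite mcoeffC.
have [->|nz_m] := eqVneq m 0%MM; first by rewrite mulr1.
by rewrite mulr0 (dhomog_nemf_coeff p0) //= mdeg_eq0.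
Qed.

(** * Renaming variables *)

Section Rename.
Variables (A : comNzRingType) (n N : nat) (s : 'I_n -> 'I_N).
Implicit Types (p h : {mpoly A[n]}) (q : {mpoly A[N]}).

(** Common form of [in_x] and [in_y], so that each fact is proved once for both blocks. *)
Definition rename p : {mpoly A[N]} := p \mPo [tuple 'X_(s i) | i < n].

HB.instance Definition _ := GRing.RMorphism.copy rename
  (comp_mpoly [tuple 'X_(s i) | i < n]).
HB.instance Definition _ := GRing.Linear.copy rename
  (comp_mpoly [tuple 'X_(s i) | i < n]).

Lemma renameC c : rename c%:MP = c%:MP.
Proof. exact: comp_mpolyC. Qed.

Lemma renameX i : rename 'X_i = 'X_(s i).
Proof. by rewrite /rename comp_mpolyXU -tnth_nth tnth_mktuple. Qed.

Lemma dhomog_rename d p : p \is d.-homog -> rename p \is d.-homog.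
Proof.
by apply: dhomog_comp => i; rewrite tnth_mktuple dhomogX /= mdeg1.
Qed.

Lemma mderiv_rename_out j p : (forall i, s i != j) -> (rename p)^`M(j) = 0.
Proof.
move=> sj; elim/mpoly_ring_ind: p => [c|i|p q IHp IHq|p q IHp IHq].
- by rewrite renameC mderivC.
- by rewrite renameX mderivX mnm1E (negbTE (sj i)) scale0r.
- by rewrite rmorphD linearD /= IHp IHq addr0.
- by rewrite rmorphM /= mderivM IHp IHq mul0r mulr0 addr0.
Qed.

Hypothesis s_inj : injective s.

(** As [s] is injective, no other variable lands on [s i], and the chain rule has a single term. *)
Lemma mderiv_rename i p : (rename p)^`M(s i) = rename p^`M(i).
Proof.
elim/mpoly_ring_ind: p => [c|j|p q IHp IHq|p q IHp IHq].
- by rewrite renameC !mderivC rmorph0.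
- rewrite renameX !mderivX !mnm1E (inj_eq s_inj) linearZ /=.
  have [-> | _] := eqVneq j i; last by rewrite !scale0r.
  rewrite !scale1r -{1}[U_(s i)%MM]add0m -{1}[U_(i)%MM]add0m !addmK.
  by rewrite !mpolyX0 rmorph1.
- by rewrite rmorphD !linearD /= IHp IHq.
- by rewrite rmorphM /= !mderivM rmorphD !rmorphM /= IHp IHq.
Qed.

(** The factor [q] behaves as a constant for operators in the renamed variables. *)
Lemma diffop_renameM h p q : (forall i, q^`M(s i) = 0) ->
  diffop (rename h) (rename p * q) = rename (diffop h p) * q.
Proof.
(* [p] stays general: in the product case the hypothesis on [h1] is applied to [diffop h2 p]. *)
move=> dq; elim/mpoly_ring_ind: h p => [c|i|h1 h2 IH1 IH2|h1 h2 IH1 IH2] p.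
- by rewrite renameC !diffopC linearZ /= scalerAl.
- by rewrite renameX !diffopXU mderivM dq mulr0 addr0 mderiv_rename.
- by rewrite rmorphD /= !diffopDl IH1 IH2 rmorphD mulrDl.
- by rewrite rmorphM /= !diffopM IH2 IH1.
Qed.

End Rename.

(** * Polynomials in two disjoint blocks of variables *)

Section TwoBlocks.
Variables (A : comNzRingType) (n m : nat).
Implicit Types (p f : {mpoly A[n]}) (q g : {mpoly A[m]}).

Lemma dhomog_in_x d p : p \is d.-homog -> in_x m p \is d.-homog.
Proof. exact: dhomog_rename. Qed.

Lemma dhomog_in_y d q : q \is d.-homog -> in_y n q \is d.-homog.
Proof. exact: dhomog_rename. Qed.

Lemma in_xXM i p : in_x m ('X_i * p) = 'X_(lshift m i) * in_x m p.
Proof. by rewrite /in_x -!/(rename _ _) rmorphM /= renameX. Qed.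

Lemma in_yXM j q : in_y n ('X_j * q) = 'X_(rshift n j) * in_y n q.
Proof. by rewrite /in_y -!/(rename _ _) rmorphM /= renameX. Qed.

Lemma mderiv_in_x i p : (in_x m p)^`M(lshift m i) = in_x m p^`M(i).
Proof. by apply: mderiv_rename; apply: lshift_inj. Qed.

Lemma mderiv_in_y j q : (in_y n q)^`M(rshift n j) = in_y n q^`M(j).
Proof. by apply: mderiv_rename; apply: rshift_inj. Qed.

Lemma mderiv_in_x_y j p : (in_x m p)^`M(rshift n j) = 0.
Proof. by apply: mderiv_rename_out => i; rewrite eq_lrshift. Qed.

Lemma mderiv_in_y_x i q : (in_y n q)^`M(lshift m i) = 0.
Proof. by apply: mderiv_rename_out => j; rewrite eq_rlshift. Qed.

Lemma diffop_in_x f p q :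
  diffop (in_x m f) (in_x m p * in_y n q) = in_x m (diffop f p) * in_y n q.
Proof.
by apply: diffop_renameM => [|i]; [exact: lshift_inj | exact: mderiv_in_y_x].
Qed.

Lemma diffop_in_y g p q :
  diffop (in_y n g) (in_x m p * in_y n q) = in_x m p * in_y n (diffop g q).
Proof.
rewrite mulrC [RHS]mulrC.
by apply: diffop_renameM => [|j]; [exact: rshift_inj | exact: mderiv_in_x_y].
Qed.

End TwoBlocks.

(** Both factors are nonzero constants of an integral domain. This gives condition (ii) in parts (2)
    to (4). *)
Lemma in_x0M_neq0 (A : idomainType) n m (p : {mpoly A[n]}) (q : {mpoly A[m]}) :
  p \is 0.-homog -> q \is 0.-homog -> p != 0 -> q != 0 ->
  in_x m p * in_y n q != 0.
Proof.
move=> /dhomog0_const-> /dhomog0_const->; rewrite !mpolyC_eq0 => p0 q0.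
by rewrite /in_x /in_y !comp_mpolyC -mpolyCM mpolyC_eq0 mulf_neq0.
Qed.

(** A multi-index of length one amounts to its degree. *)
Lemma propertyP_single (A : comNzRingType) N d (f : {mpoly A[N]}) :
  propertyP d (single f) <->
  f \is d.-homog /\
  exists P : nat -> {mpoly A[N]},
    [/\ forall j, P j \is (d * j).-homog, P 0%N != 0
      & forall i j, 'X_i * P j = diffop f^`M(i) (P j.+1)].
Proof.
split=> [[fd [P [Pd P0 PX]]] | [fd [P [Pd P0 PX]]]].
  split; first exact: (fd ord0).
  have E (j : nat) :
      (U_(ord0) *+ j + U_(ord0) = U_(ord0) *+ j.+1 :> 'X_{1..1})%MM.
    by rewrite mulmSr.
  exists (fun j => P (U_(ord0) *+ j)%MM); split=> [j||i j].
  - by have := Pd (U_(ord0) *+ j)%MM; rewrite mdegMn mdeg1 mul1n.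
  - by rewrite mulm0n.
  - by rewrite PX big_ord1 E.
split=> [k|]; first exact: fd.
exists (fun alpha => P (mdeg alpha)); split=> [//||i alpha].
- by rewrite mdeg0.
- by rewrite PX big_ord1 mdegD mdeg1 addn1.
Qed.

(** * Families with a larger span *)

Lemma propertyP_span (A : comNzRingType) n d l r (g : 'I_l -> {mpoly A[n]})
    (f : 'I_r -> {mpoly A[n]}) (c : 'I_l -> 'I_r -> A) :
  (forall k, f k \is d.-homog) ->
  (forall a, g a = \sum_(k < r) c a k *: f k) ->
  propertyP d g -> propertyP d f.
Proof.
move=> fd gE [_ [P [Pd P0 PX]]]; split=> //.
pose L (k : 'I_r) : {mpoly A[l]} := \sum_(a < l) c a k *: 'X_a.
pose G (alpha : 'X_{1..r}) := 'X_[alpha] \mPo [tuple L k | k < r].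
have GD alpha k : G (alpha + U_(k))%MM = \sum_(a < l) c a k *: (G alpha * 'X_a).
  rewrite /G mpolyXD rmorphM /= comp_mpolyXU -tnth_nth tnth_mktuple mulr_sumr.
  by apply: eq_bigr => a _; rewrite scalerAr.
(* Condition (iii) for [g], extended linearly: shifting beta by e_a becomes multiplication by
   t_a. *)
have mlinX_P i h :
    'X_i * mlin P h = \sum_(a < l) diffop (g a)^`M(i) (mlin P (h * 'X_a)).
  elim/mpolyind: h => [|b m h _ _ IH].
    rewrite linear0 mulr0 big1 // => a _.
    by rewrite mul0r !linear0.
  rewrite [mlin P _]linearP /= mulrDr -scalerAr mlinX PX IH scaler_sumr.
  rewrite -big_split /=.
  apply: eq_bigr => a _; rewrite mulrDl -scalerAl -mpolyXD.
  by rewrite [mlin P (_ + _)]linearP /= mlinX linearP.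
exists (fun alpha => mlin P (G alpha)); split=> [alpha||i alpha].
- have Ghom : G alpha \is (mdeg alpha).-homog.
    apply: dhomog_comp => [k|]; last by rewrite dhomogX.
    rewrite tnth_mktuple; apply: rpred_sum => a _.
    by apply: dhomogZ; rewrite dhomogX /= mdeg1.
  rewrite /mlin big_seq; apply: rpred_sum => m mG; apply: dhomogZ.
  by rewrite -(dhomogP _ _ _ Ghom _ mG).
- by rewrite /G mpolyX0 rmorph1 -mpolyX0 mlinX.
(* Expanding each g_a in the f_k and exchanging sums reassembles the linear form [L k], hence the
   shift of [alpha] by e_k. *)
- rewrite mlinX_P; under eq_bigr => a _ do
    rewrite gE [mderiv _ _]linear_sum /= diffop_suml.
  rewrite exchange_big; apply: eq_bigr => k _ /=.
  rewrite GD [mlin P _]linear_sum [diffop _ _]linear_sum /=.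
  apply: eq_bigr => a _.
  by rewrite linearZ diffopZl /= !linearZ.
Qed.

(** * Joining families in disjoint variables *)

Lemma propertyP_concat (A : idomainType) n m d r l
    (f : 'I_r -> {mpoly A[n]}) (g : 'I_l -> {mpoly A[m]}) :
  propertyP d f -> propertyP d g ->
  propertyP d (concat_family (fun k => in_x m (f k)) (fun a => in_y n (g a))).
Proof.
move=> [fd [P [Pd P0 PX]]] [gd [Q [Qd Q0 QX]]].
set F := concat_family _ _.
have FL k : F (lshift l k) = in_x m (f k).
  by rewrite /F /concat_family -[lshift _ _]/(unsplit (inl k)) unsplitK.
have FR a : F (rshift r a) = in_y n (g a).
  by rewrite /F /concat_family -[rshift _ _]/(unsplit (inr a)) unsplitK.
split=> [k|].
  by have [k' ->|a ->] := split_ordP k; rewrite ?FL ?FR;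
    [apply: dhomog_in_x | apply: dhomog_in_y].
(* The two blocks of a multi-index; a shift by a basis vector affects exactly one of them. *)
pose al (alpha : 'X_{1..r + l}) := [multinom alpha (lshift l k) | k < r].
pose ar (alpha : 'X_{1..r + l}) := [multinom alpha (rshift r a) | a < l].
have mdeg_lr alpha : mdeg alpha = (mdeg (al alpha) + mdeg (ar alpha))%N.
  by rewrite !mdegE big_split_ord; congr (_ + _)%N;
    apply: eq_bigr => k _; rewrite mnmE.
have alL alpha k : al (alpha + U_(lshift l k))%MM = (al alpha + U_(k))%MM.
  by apply/mnmP => k'; rewrite !(mnmE, mnmDE, mnm1E) eq_lshift.
have arL alpha k : ar (alpha + U_(lshift l k))%MM = ar alpha.
  by apply/mnmP => a'; rewrite !(mnmE, mnmDE, mnm1E) eq_lrshift addn0.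
have alR alpha a : al (alpha + U_(rshift r a))%MM = al alpha.
  by apply/mnmP => k'; rewrite !(mnmE, mnmDE, mnm1E) eq_rlshift addn0.
have arR alpha a : ar (alpha + U_(rshift r a))%MM = (ar alpha + U_(a))%MM.
  by apply/mnmP => a'; rewrite !(mnmE, mnmDE, mnm1E) eq_rshift.
have al0 : al 0%MM = 0%MM by apply/mnmP => k; rewrite mnmE !mnm0E.
have ar0 : ar 0%MM = 0%MM by apply/mnmP => a; rewrite mnmE !mnm0E.
exists (fun alpha => in_x m (P (al alpha)) * in_y n (Q (ar alpha))).
split=> [alpha||i alpha].
- by rewrite mdeg_lr mulnDr; apply: dhomogM;
    [apply: dhomog_in_x | apply: dhomog_in_y].
- rewrite al0 ar0; apply: in_x0M_neq0 => //.
    by have := Pd 0%MM; rewrite mdeg0 muln0.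
  by have := Qd 0%MM; rewrite mdeg0 muln0.
- rewrite big_split_ord /=.
  have [i' ->|j ->] := split_ordP i.
    (* For an x-variable the terms from [g] vanish; what remains is condition (iii) for [f] times
       the Q-factor. *)
    rewrite [X in _ + X]big1 ?addr0 => [|a _]; last first.
      by rewrite FR mderiv_in_y_x diffop0l.
    rewrite mulrA -in_xXM PX /in_x -!/(rename _ _) linear_sum mulr_suml.
    apply: eq_bigr => k _; rewrite FL mderiv_in_x alL arL.
    by rewrite diffop_in_x.
  rewrite [X in X + _]big1 ?add0r => [|k _]; last first.
    by rewrite FL mderiv_in_x_y diffop0l.
  rewrite mulrCA -in_yXM QX /in_y -!/(rename _ _) linear_sum mulr_sumr.
  apply: eq_bigr => a _; rewrite FR mderiv_in_y alR arR.
  by rewrite diffop_in_y.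
Qed.

(** * Sums in disjoint variables *)

Lemma propertyP_add (A : idomainType) n m d (f : {mpoly A[n]})
    (g : {mpoly A[m]}) :
  (1 < d)%N -> propertyP d (single f) -> propertyP d (single g) ->
  propertyP d (single (in_x m f + in_y n g)).
Proof.
move=> d_gt1 /propertyP_single[fd [P [Pd P0 PX]]].
move=> /propertyP_single[gd [Q [Qd Q0 QX]]].
(* From [1 < d], the derivatives of [f] and [g] have positive degree and so kill the constants [P 0]
   and [Q 0]. *)
have dpred_gt0 : (0 < d.-1)%N by rewrite -ltnS prednK // ltnW.
have P00 : P 0%N \is 0.-homog by have := Pd 0%N; rewrite muln0.
have Q00 : Q 0%N \is 0.-homog by have := Qd 0%N; rewrite muln0.
apply/propertyP_single; split.
  by apply: rpredD; [apply: dhomog_in_x | apply: dhomog_in_y].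
exists (fun k => \sum_(j < k.+1) in_x m (P j) * in_y n (Q (k - j)%N)).
split=> [k||i k].
- apply: rpred_sum => j _; rewrite -[X in (d * X)%N](subnKC (leq_ord j)).
  by rewrite mulnDr; apply: dhomogM; [apply: dhomog_in_x | apply: dhomog_in_y].
- by rewrite big_ord1; apply: in_x0M_neq0.
have [i' ->|i' ->] := split_ordP i.
- rewrite mderivD mderiv_in_x mderiv_in_y_x addr0.
  (* The sum for [k.+1] has one term more. Here the surplus is [j = 0], and the other terms match
     after shifting [j]. *)
  rewrite [in RHS]big_ord_recl linearD /=.
  rewrite diffop_in_x (diffop_dhomog0 P00 (dhomog_deriv i' fd)) //.
  rewrite /in_x comp_mpoly0 mul0r add0r -!/(in_x _ _).
  rewrite mulr_sumr linear_sum /=; apply: eq_bigr => j _.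
  by rewrite mulrA -in_xXM PX diffop_in_x.
- rewrite mderivD mderiv_in_y mderiv_in_x_y add0r.
  (* Here the surplus is [j = k.+1], which carries [Q 0]; the other terms match without a shift. *)
  rewrite [in RHS]big_ord_recr linearD /=.
  rewrite subnn diffop_in_y (diffop_dhomog0 Q00 (dhomog_deriv i' gd)) //.
  rewrite /in_y comp_mpoly0 mulr0 addr0 -!/(in_y _ _).
  rewrite mulr_sumr linear_sum /=; apply: eq_bigr => j _.
  by rewrite mulrCA -in_yXM QX diffop_in_y subSn // leq_ord.
Qed.

(** * Products in disjoint variables *)

(* Apply [\sum_i \partial_i] to condition (iii) and use Euler's identity on
   both sides. *)
Lemma diffop_lower (A : numFieldType) N d (f : {mpoly A[N]})
    (P : nat -> {mpoly A[N]}) j :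
  (0 < d)%N -> f \is d.-homog -> (forall k, P k \is (d * k).-homog) ->
  (forall i k, 'X_i * P k = diffop f^`M(i) (P k.+1)) ->
  diffop f (P j.+1) = (N%:R / d%:R + j%:R) *: P j.
Proof.
move=> d_gt0 fd Pd PX; have d_neq0 : d%:R != 0 :> A by rewrite pnatr_eq0 -lt0n.
apply: (scalerI d_neq0); rewrite -diffopZl -(euler fd) diffop_suml.
rewrite scalerA mulrDr mulrCA divff // mulr1 -natrM -natrD.
rewrite -(sum_deriv_mulX (Pd j)); apply: eq_bigr => i _.
by rewrite PX diffopM diffopXU.
Qed.

Lemma propertyP_mul (A : numFieldType) n m d e (f : {mpoly A[n]})
    (g : {mpoly A[m]}) :
  (0 < d)%N -> (0 < e)%N -> n%:R / d%:R = m%:R / e%:R :> A ->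
  propertyP d (single f) -> propertyP e (single g) ->
  propertyP (d + e) (single (in_x m f * in_y n g)).
Proof.
move=> d_gt0 e_gt0 lamE /propertyP_single[fd [P [Pd P0 PX]]].
move=> /propertyP_single[ge [Q [Qe Q0 QX]]].
have P00 : P 0%N \is 0.-homog by have := Pd 0%N; rewrite muln0.
have Q00 : Q 0%N \is 0.-homog by have := Qe 0%N; rewrite muln0.
have fP j := diffop_lower j d_gt0 fd Pd PX.
have gQ j := diffop_lower j e_gt0 ge Qe QX.
pose lam j : A := n%:R / d%:R + j%:R.
(* The junk value [0^-1 = 0], met when [n = m = 0], is harmless: condition
   (iii) is then void. *)
pose c j := \prod_(i < j) (lam i)^-1.
(* A nonzero [lam 0] forces [n > 0], so every [lam j] is positive and can be cancelled. *)
have cS j : lam 0%N != 0 -> c j.+1 * lam j = c j.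
  move=> lam0; rewrite /c big_ord_recr /= mulfVK //.
  rewrite /lam addr0 in lam0.
  have n_gt0 : (0 < n)%N.
    by rewrite lt0n; apply: contraNneq lam0 => ->; rewrite mul0r.
  by rewrite lt0r_neq0 // ltr_wpDr ?ler0n // divr_gt0 // ltr0n.
apply/propertyP_single; split.
  by apply: dhomogM; [apply: dhomog_in_x | apply: dhomog_in_y].
exists (fun j => c j *: (in_x m (P j) * in_y n (Q j))); split=> [j||i j].
- apply: dhomogZ; rewrite mulnDl.
  by apply: dhomogM; [apply: dhomog_in_x | apply: dhomog_in_y].
- by rewrite /c big_ord0 scale1r; apply: in_x0M_neq0.
have [i' ->|i' ->] := split_ordP i.
(* The existence of the index [i'] forces [n > 0]. *)
- have lam0 : lam 0%N != 0.
    rewrite /lam addr0 mulf_neq0 ?invr_neq0 // pnatr_eq0 -lt0n //.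
    exact: leq_ltn_trans (ltn_ord i').
  (* The symbol is (\partial_i f) g: g(\partial) yields [lam j] times [Q j], and (\partial_i
     f)(\partial) yields x_i times [P j]. *)
  rewrite mderivM mderiv_in_x mderiv_in_y_x mulr0 addr0 linearZ /= diffopM.
  rewrite diffop_in_y diffop_in_x gQ -lamE -/(lam j) -PX /in_y comp_mpolyZ.
  by rewrite -!/(in_y _ _) -!scalerAr scalerA cS // mulrA -in_xXM.
- have lam0 : lam 0%N != 0.
    rewrite /lam addr0 lamE mulf_neq0 ?invr_neq0 // pnatr_eq0 -lt0n //.
    exact: leq_ltn_trans (ltn_ord i').
  rewrite mderivM mderiv_in_y mderiv_in_x_y mul0r add0r linearZ /=.
  rewrite [in_x m f * _]mulrC diffopM.
  rewrite diffop_in_x diffop_in_y fP -/(lam j) -QX /in_x comp_mpolyZ.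
  by rewrite -!/(in_x _ _) -scalerAl -scalerAr scalerA cS // mulrCA -in_yXM.
Qed.

Theorem theoremC (R : realType) :
  [/\ (forall (n d l r : nat)
          (g : 'I_l -> {mpoly R[i][n]}) (f : 'I_r -> {mpoly R[i][n]}),
        (forall a, g a \is d.-homog) ->
        (forall k, f k \is d.-homog) ->
        (forall a, exists c : 'I_r -> R[i], g a = \sum_(k < r) c k *: f k) ->
        propertyP d g -> propertyP d f),
      (forall (n m d r l : nat)
          (f : 'I_r -> {mpoly R[i][n]}) (g : 'I_l -> {mpoly R[i][m]}),
        (forall k, f k \is d.-homog) ->
        (forall a, g a \is d.-homog) ->
        propertyP d f -> propertyP d g ->
        propertyP d (concat_family (fun k => in_x m (f k))
                                   (fun a => in_y n (g a)))),
      (forall (n m d e : nat) (f : {mpoly R[i][n]}) (g : {mpoly R[i][m]}),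
        (0 < d)%N -> (0 < e)%N ->
        f \is d.-homog -> g \is e.-homog ->
        n%:R / d%:R = m%:R / e%:R :> rat ->
        propertyP d (single f) -> propertyP e (single g) ->
        propertyP (d + e) (single (in_x m f * in_y n g)))
    & (forall (n m d : nat) (f : {mpoly R[i][n]}) (g : {mpoly R[i][m]}),
        (2 <= d)%N ->
        f \is d.-homog -> g \is d.-homog ->
        propertyP d (single f) -> propertyP d (single g) ->
        propertyP d (single (in_x m f + in_y n g)))].
Proof.
split.
- move=> n d l r g f _ fd /fin_all_exists[c gE].
  exact: propertyP_span fd gE.
- by move=> n m d r l f g _ _; apply: propertyP_concat.
- move=> n m d e f g d_gt0 e_gt0 _ _ nd_me; apply: propertyP_mul => //.
  (* The equality of ratios is carried from the rationals to [R[i]] by the field embedding. *)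
  by have := congr1 (ratr : rat -> R[i]) nd_me; rewrite !fmorph_div !rmorph_nat.
- by move=> n m d f g d_gt1 _ _; apply: propertyP_add.
Qed.
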